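(* Let $n\ge1$, let $\lambda=(\lambda_1\ge\cdots\ge\lambda_n\ge0)$ be a partition (padded with zeros to length $n$), and set $A_{ij}=\lambda_i-\lambda_j+j-i$ for $1\le i<j\le n$. Then for every $\beta\in\mathbb{C}$, $$G_\lambda(\underbrace{1,\dots,1}_{n}\mid\beta)=|\mathrm{SST}(\lambda,n)|\cdot F^{(n)}\big((A_{ij})\,\big|\,(0,-1,\dots,-(n-1))^{T}\,\big|\,(1,\dots,1)^T\,\big|\,(-\beta,\dots,-\beta)^T\big),$$ where explicitly $$F^{(n)}\big((A_{ij})\,|\,(0,-1,\dots,-(n-1))^T\,|\,(1,\dots,1)^T\,|\,(z,\dots,z)^T\big)=\sum_{k_1,\dots,k_n\ge0}\Big(\prod_{1\le i<j\le n}\frac{A_{ij}+k_i-k_j}{A_{ij}}\Big)\prod_{i=1}^n\frac{(-(i-1))_{k_i}}{(1)_{k_i}}\,z^{k_i}$$ (a finite sum, since $(-(i-1))_{k_i}=0$ for $k_i>i-1$).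
   Context: Holman's hypergeometric function is $F^{(n)}\big((A_{ij})_{1\le i<j\le n}\,|\,(a_{ij})_{n\times u}\,|\,(b_{ij})_{n\times v}\,|\,(z_i)_{n\times1}\big)=\sum_{k_1,\dots,k_n\ge0}\Big(\prod_{i<j}\frac{A_{ij}+k_i-k_j}{A_{ij}}\Big)\Big(\prod_{j=1}^u\prod_{i=1}^n(a_{ij})_{k_i}\Big)\Big(\prod_{j=1}^v\prod_{i=1}^n\frac{1}{(b_{ij})_{k_i}}\Big)\prod_{i=1}^n z_i^{k_i}$, with $(a)_0=1$, $(a)_m=a(a+1)\cdots(a+m-1)$. Note $A_{ij}\ge1$ here. $\mathrm{SST}(\lambda,n)$ is the set of semistandard tableaux of shape $\lambda$ with entries in $[n]=\{1,\dots,n\}$ (rows weakly increasing, columns strictly increasing), and $|\mathrm{SST}(\lambda,n)|=\prod_{1\le i<j\le n}\frac{\lambda_i-\lambda_j+j-i}{j-i}$. The Grothendieck polynomial is $G_\lambda(x_1,\dots,x_n\mid\beta)=\sum_{T\in\mathrm{SVT}(\lambda,n)}\beta^{|T|-|\lambda|}x^{\omega(T)}$, where $\mathrm{SVT}(\lambda,n)$ is the set of set-valued tableaux: each box $(i,j)$ of the Young diagram of $\lambda$ (row $i$ downward, column $j$ rightward) gets a nonempty $T_{i,j}\subseteq[n]$ with $\max T_{i,j}\le\min T_{i,j+1}$ and $\max T_{i,j}<\min T_{i+1,j}$; $|T|=\sum|T_{i,j}|$, $|\lambda|=\sum\lambda_i$, $x^{\omega(T)}=\prod_m x_m^{\#\{\text{boxes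 whose set contains }m\}}$. *)

(* Defs.v *)
From HB Require Import structures.
From mathcomp Require Import all_boot all_order all_algebra.
Set Implicit Arguments. Unset Strict Implicit. Unset Printing Implicit Defensive.
Import Order.TTheory GRing.Theory Num.Theory.
Local Open Scope ring_scope.

(* Entries of tableaux live in 'I_n.+1; the value 0 is excluded, so the
   admissible entries are exactly [n] = {1,...,n}.  Boxes of the Young diagram
   of lam are the pairs (i,j) : 'I_n * 'I_M with j < lam i (0-based rows and
   columns), where M = max_i lam i. *)

Section Tableaux.
Variables (n : nat) (lam : 'I_n -> nat).

Definition lam_max : nat := (\max_(i < n) lam i)%N.
Definition box := ('I_n * 'I_lam_max)%type.
Definition inside (b : box) : bool := (b.2 < lam b.1)%N.
Definition lam_size : nat := (\sum_(i < n) lam i)%N.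

Definition right_of (b1 b2 : box) : bool :=
  (b1.1 == b2.1) && (b2.2 == (b1.2).+1 :> nat).
Definition below (b1 b2 : box) : bool :=
  (b2.1 == (b1.1).+1 :> nat) && (b1.2 == b2.2 :> nat).

Definition is_svt (T : {ffun box -> {set 'I_n.+1}}) : bool :=
  [forall b, if inside b then (T b != set0) && (ord0 \notin T b)
             else T b == set0]
  && [forall b1, forall b2, (inside b1 && inside b2 && right_of b1 b2) ==>
        [forall a in T b1, forall c in T b2, (a <= c)%N]]
  && [forall b1, forall b2, (inside b1 && inside b2 && below b1 b2) ==>
        [forall a in T b1, forall c in T b2, (a < c)%N]].

Definition SVT := [set T | is_svt T].

(* semistandard tableaux of shape lam with entries in [n]
   (boxes outside the diagram carry the dummy value 0) *)
Definition is_sst (T : {ffun box -> 'I_n.+1}) : bool :=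
  [forall b, if inside b then T b != ord0 else T b == ord0]
  && [forall b1, forall b2, (inside b1 && inside b2 && right_of b1 b2) ==>
        (T b1 <= T b2)%N]
  && [forall b1, forall b2, (inside b1 && inside b2 && below b1 b2) ==>
        (T b1 < T b2)%N].

Definition SST := [set T | is_sst T].

Definition svt_size (T : {ffun box -> {set 'I_n.+1}}) : nat :=
  (\sum_(b : box) #|T b|)%N.

Definition svt_weight (C : comNzRingType) (x : nat -> C)
    (T : {ffun box -> {set 'I_n.+1}}) : C :=
  \prod_(m : 'I_n.+1 | m != ord0)
     x m ^+ #|[set b : box | inside b && (m \in T b)]|.

Definition grothendieck (C : comNzRingType) (x : nat -> C) (beta : C) : C :=
  \sum_(T in SVT) beta ^+ (svt_size T - lam_size) * svt_weight x T.

End Tableaux.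

Definition poch (C : comNzRingType) (a : C) (k : nat) : C :=
  \prod_(i < k) (a + i%:R).

Definition holmanF_trunc (C : fieldType) (n u v N : nat)
    (A : 'I_n -> 'I_n -> C) (a : 'M[C]_(n, u)) (b : 'M[C]_(n, v))
    (z : 'I_n -> C) : C :=
  \sum_(k : {ffun 'I_n -> 'I_N})
    (\prod_(i < n) \prod_(j < n | (i < j)%N)
        ((A i j + (k i)%:R - (k j)%:R) / A i j))
    * (\prod_(j < u) \prod_(i < n) poch (a i j) (k i))
    * (\prod_(j < v) \prod_(i < n) (poch (b i j) (k i))^-1)
    * (\prod_(i < n) z i ^+ k i).

(* A_ij = lam_i - lam_j + j - i (rows 0-based; the difference j - i is the
   same as for 1-based indices) *)
Definition holA (C : fieldType) (n : nat) (lam : 'I_n -> nat) :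
    'I_n -> 'I_n -> C :=
  fun i j => (lam i)%:R - (lam j)%:R + (j : nat)%:R - (i : nat)%:R.

Definition holA_col (C : fieldType) (n : nat) : 'M[C]_(n, 1) :=
  \matrix_(i < n, j < 1) - (i : nat)%:R.

(* Main.v *)
Require Import Defs.
From HB Require Import structures.
From mathcomp Require Import all_boot all_order all_algebra.
From mathcomp Require Import zify ring.
Import Order.TTheory GRing.Theory Num.Theory.
Local Open Scope ring_scope.

(* Erasing the largest entry of a set-valued tableau of shape [la] leaves a
   tableau of a shape [mu] interlaced with [la]; in each row the boxes holding
   the erased entry form an interval that ends at [la i] and meets row [i] of
   [mu] in at most one box.  This branching rule is also satisfied by the
   determinant of the rows [((1 + beta E)^i 'C(., q))(la i + n - 1 - i)], with
   [E] the shift: replacing row [i] by [1 + beta] times itself minus row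
   [i + 1] clears the last column.  Expanding the powers of [1 + beta E] row by
   row writes the determinant as a sum of binomial determinants, each of which
   is a constant times a Vandermonde product; the case [beta = 0] counts
   semistandard tableaux, and the quotients are the factors of Holman's
   series. *)

(** Extension by 0 turns shapes into functions on [nat], so that the row after the last one can be
    named. *)
Definition pad n (f : 'I_n -> nat) (i : nat) : nat := oapp f 0%N (insub i).

Lemma pad_ord n (f : 'I_n -> nat) (i : 'I_n) : pad n f i = f i.
Proof. by rewrite /pad valK. Qed.

Lemma pad_ge n (f : 'I_n -> nat) i : (n <= i)%N -> pad n f i = 0%N.
Proof. by move=> lein; rewrite /pad insubF //= ltnNge lein. Qed.

(** * Shifted binomial determinants and their branching recursion *)

Section Determinants.
Variables (R : comNzRingType) (beta : R).

(* [(1 + beta E)^r] applied to [h |-> 'C(h, q)], where [(E f) h = f h.+1]. *)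
Fixpoint binshift (r q h : nat) : R :=
  if r is r'.+1 then binshift r' q h + beta * binshift r' q h.+1
  else 'C(h, q)%:R.

(** Constants are fixed by [E]; hence the column [q = 0] depends on the row index alone and can be
    cleared by row operations. *)
Lemma binshift0 r h : binshift r 0 h = (1 + beta) ^+ r.
Proof.
elim: r h => [|r IHr] h /=; first by rewrite bin0 expr0.
by rewrite !IHr exprS; ring.
Qed.

(** Pascal's rule survives because [1 + beta E] is linear and commutes with [E]. *)
Lemma binshift_pascal r q h :
  binshift r q.+1 h.+1 = binshift r q.+1 h + binshift r q h.
Proof.
elim: r h => [|r IHr] h; first by rewrite /= binS natrD.
by rewrite /= !IHr; ring.
Qed.

(** This is the binomial expansion of [(1 + beta E)^r]; terms with [k > r] vanish, so one bound [N]
    can serve all rows. *)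
Lemma binshift_sum r q h N : (r < N)%N ->
  binshift r q h = \sum_(k < N) 'C(r, k)%:R * beta ^+ k * 'C(h + k, q)%:R.
Proof.
elim: r h N => [|r IHr] h [|N] // ltrN.
  rewrite big_ord_recl big1 => [|i _]; last by rewrite bin0n /= !mul0r.
  by rewrite /= addn0 addr0 bin0 expr0 !mul1r.
rewrite /= (IHr _ N.+1); last by lia.
rewrite (IHr _ N) // mulr_sumr !big_ord_recl /= !bin0 -addrA -big_split /=.
congr (_ + _); apply: eq_bigr => k _.
by rewrite /bump /= !add1n binS natrD addSnnS exprS; ring.
Qed.

Lemma sum_binshift r q a b c : (a <= b)%N ->
  \sum_(a <= u < b) binshift r q (u + c)
    = binshift r q.+1 (b + c) - binshift r q.+1 (a + c).
Proof.
move=> leab; rewrite -(telescope_sumr (fun u => binshift r q.+1 (u + c))) //.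
by apply: eq_bigr => u _; rewrite addSn binshift_pascal addrC addKr.
Qed.

(** [rev_ord i] stands for [m - 1 - i]. Reversing the columns puts [q = 0] last, where the recursion
    clears it. *)
Definition shape_det m (la : nat -> nat) : R :=
  \det (\matrix_(i < m, j < m) binshift i (rev_ord j) (la i + rev_ord i)).

(** Multilinearity in the rows: in the Leibniz formula a product of row sums distributes over the
    functions [p] choosing one term per row. *)
Lemma det_rows_sum m (I : finType) (P : 'I_m -> pred I)
    (c : 'I_m -> I -> R) (f : 'I_m -> I -> 'I_m -> R) :
  \det (\matrix_(i, j) \sum_(u | P i u) c i u * f i u j)
  = \sum_(p : {ffun 'I_m -> I} | [forall i, P i (p i)])
      (\prod_i c i (p i)) * \det (\matrix_(i, j) f i (p i) j).
Proof.
rewrite /determinant; under [RHS]eq_bigr do rewrite mulr_sumr.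
rewrite exchange_big /=; apply: eq_bigr => s _.
under eq_bigr do rewrite mxE.
rewrite bigA_distr_big_dep mulr_sumr.
apply: eq_big => [p|p _]; first by apply/familyP/forallP => h i; apply: h.
rewrite big_split /= mulrCA; congr (_ * (_ * _)).
by apply: eq_bigr => i _; rewrite mxE.
Qed.

Lemma sum_interval M a b (f : nat -> R) : (b <= M)%N ->
  \sum_(u < M.+1 | (a <= u <= b)%N) f u = \sum_(a <= u < b.+1) f u.
Proof.
move=> leM; rewrite (big_nat_widen _ _ M.+1) //.
rewrite (big_nat_widenl a 0) // big_mkord; apply: eq_bigl => u.
by rewrite andTb ltnS andbC.
Qed.

(* The pairs [(u, x)] are the possible rows [u] of the smaller shape, with [x]
   telling whether the last box of that row also holds the erased entry. *)
Lemma sum_marked M r q a b c : (a <= b <= M)%N ->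
  \sum_(ux : 'I_M.+1 * bool | (a + ux.2 <= ux.1 <= b)%N)
     beta ^+ ux.2 * binshift r q (ux.1 + c)
  = (1 + beta) * binshift r q.+1 (b + c).+1 - binshift r.+1 q.+1 (a + c).
Proof.
move=> /andP[leab lebM].
rewrite -(pair_big_dep xpredT (fun u x => (a + nat_of_bool x <= nat_of_ord u <= b)%N)
  (fun (u : 'I_M.+1) (x : bool) => beta ^+ x * binshift r q (u + c))) /=.
rewrite (exchange_big_dep xpredT) //= big_bool /=.
rewrite addn0 addn1 expr1 expr0.
under [X in _ + X]eq_bigr do rewrite mul1r.
rewrite -mulr_sumr.
rewrite (sum_interval _ _ _ (fun u => binshift r q (u + c))) //.
rewrite (sum_interval _ _ _ (fun u => binshift r q (u + c))) //.
rewrite !sum_binshift //; last by lia.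
by rewrite /= !addSn !binshift_pascal; ring.
Qed.

(** Clearing the last column leaves an [m] by [m] minor whose entries are the sums of [sum_marked];
    multilinearity splits it into smaller shape determinants. The power of [1 + beta] stays on both
    sides because it may not be cancellable in [R]. *)
Lemma shape_det_rec m M (la : nat -> nat) :
  (forall i, la i.+1 <= la i)%N -> (la 0 <= M)%N ->
  (1 + beta) ^+ m * shape_det m.+1 la
  = (1 + beta) ^+ m *
    \sum_(p : {ffun 'I_m -> 'I_M.+1 * bool} |
            [forall i : 'I_m, (la i.+1 + (p i).2 <= (p i).1 <= la i)%N])
      (\prod_i beta ^+ (p i).2)
       * shape_det m (pad m (fun i => (p i).1)).
Proof.
move=> la_dec la0.
have laM i : (la i <= M)%N by elim: i => // i IHi; apply: leq_trans IHi.
(* Left multiplication by [L] replaces each row but the last by [1 + beta] times itself minus the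
   next row. [L] is upper bidiagonal, so its determinant is read off the diagonal. *)
pose L : 'M[R]_m.+1 := \matrix_(i, j)
  ((if i == j then if i == ord_max then 1 else 1 + beta else 0)
   - (j == i.+1 :> nat)%:R).
have detL : \det L = (1 + beta) ^+ m.
  rewrite -det_tr det_trig; last first.
    apply/is_trig_mxP => i j ltij; rewrite !mxE.
    by rewrite -val_eqE /= gtn_eqF // ltn_eqF ?subr0 // ltnW.
  rewrite big_ord_recr /= !mxE !eqxx /= ltn_eqF // subr0 mulr1.
  rewrite -[X in _ ^+ X]card_ord -prodr_const; apply: eq_bigr => i _.
  by rewrite !mxE eqxx -val_eqE /= ltn_eqF // ltn_eqF // subr0.
rewrite /shape_det -detL -det_mulmx.
set A := \matrix_(i, j) _.
have LAmax j : (L *m A) ord_max j = A ord_max j.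
  rewrite mxE (bigD1 ord_max) //= big1 => [|k nk].
    by rewrite mxE !eqxx ltn_eqF // subr0 mul1r addr0.
  by rewrite mxE eq_sym (negPf nk) ltn_eqF ?subr0 ?mul0r // ltn_ord.
have LAlt (i : 'I_m) j : (L *m A) (lift ord_max i) j =
    (1 + beta) * A (lift ord_max i) j - A (lift ord0 i) j.
  have ne : lift ord0 i != lift ord_max i.
    by rewrite -val_eqE /= /bump /= leqNgt ltn_ord add0n add1n gtn_eqF.
  have vmax : lift ord_max i = i :> nat by rewrite lift_max.
  have L1 : L (lift ord_max i) (lift ord_max i) = 1 + beta.
    have nemax : (lift ord_max i == ord_max) = false.
      by rewrite eq_sym (negPf (neq_lift _ _)).
    by rewrite mxE eqxx nemax vmax ltn_eqF // subr0.
  have L2 : L (lift ord_max i) (lift ord0 i) = -1.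
    by rewrite mxE eq_sym (negPf ne) vmax lift0 eqxx sub0r.
  rewrite mxE (bigD1 (lift ord_max i)) // (bigD1 (lift ord0 i)) // L1 L2 mulN1r.
  rewrite big1 /= ?addr0 // => k /andP[k1 k2]; rewrite mxE eq_sym (negPf k1) sub0r.
  by rewrite vmax -lift0 val_eqE (negPf k2) oppr0 mul0r.
have rev0 : rev_ord (ord_max : 'I_m.+1) = ord0.
  by apply: val_inj; rewrite /= subnn.
(* Only the corner entry [(1 + beta) ^+ m] survives in the last column. It supplies the factor on
   the right-hand side, while [\det L] supplies the one on the left. *)
rewrite (expand_det_col _ ord_max) big_ord_recr /= big1 => [|i _]; last first.
  rewrite (_ : widen_ord _ _ = lift ord_max i); last first.
    by apply: val_inj; exact/esym/lift_max.
  by rewrite LAlt !mxE rev0 !binshift0 lift_max lift0 -exprS subrr mul0r.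
rewrite LAmax !mxE rev0 binshift0 add0r {}detL; congr (_ * _).
rewrite /cofactor addnn -signr_odd odd_double expr0 mul1r.
transitivity (\det (\matrix_(i, j)
    \sum_(ux : 'I_M.+1 * bool | (la i.+1 + ux.2 <= ux.1 <= la i)%N)
      beta ^+ ux.2 * binshift i (rev_ord j : 'I_m) (ux.1 + rev_ord i))); last first.
  rewrite (det_rows_sum _ _ _ (fun _ (ux : 'I_M.+1 * bool) => beta ^+ ux.2)
    (fun i ux j => binshift i (rev_ord j) (ux.1 + rev_ord i))).
  apply: eq_bigr => p _; congr (_ * \det _); apply/matrixP => i j.
  by rewrite !mxE pad_ord.
congr (\det _); apply/matrixP => i j.
rewrite [LHS]mxE mxE LAlt !mxE sum_marked ?la_dec ?laM //.
(* Reversed indices grow by one from size [m] to size [m.+1], which yields the successors in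
   [sum_marked]; for the subtracted row [i.+1] the two shifts cancel. *)
rewrite lift_max lift0.
have -> : rev_ord (lift ord_max j) = (rev_ord j).+1 :> nat.
  by rewrite /= /bump leqNgt ltn_ord add0n -subSn.
have -> : rev_ord (lift ord_max i) = (rev_ord i).+1 :> nat.
  by rewrite /= /bump leqNgt ltn_ord add0n -subSn.
have -> : rev_ord (lift ord0 i) = (rev_ord i) :> nat by rewrite /= subSS.
by rewrite addnS.
Qed.
End Determinants.

(** * Set-valued fillings with bounded entries, and removal of the largest entry *)

Section Fillings.
Variables n M : nat.
Local Notation cell := ('I_n * 'I_M)%type.
Local Notation filling := {ffun cell -> {set 'I_n.+1}}.
Implicit Types (T : filling) (la mu nu : nat -> nat) (b : cell).

(** The ambient rectangle is fixed, so fillings of all shapes share one type. Boxes outside [mu] are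
    empty, which makes the row and column conditions vacuous there. *)
Definition svt_upto (m : nat) mu T : bool :=
  [&& [forall b, (T b != set0) == (b.2 < mu b.1)%N],
      [forall b, forall a in T b, (0 < a <= m)%N],
      [forall b : cell, forall b' : cell, (b.1 == b'.1) && (b'.2 == b.2.+1 :> nat) ==>
         [forall a in T b, forall c in T b', (a <= c)%N]]
    & [forall b : cell, forall b' : cell, (b'.1 == b.1.+1 :> nat) && (b.2 == b'.2) ==>
         [forall a in T b, forall c in T b', (a < c)%N]]].

Lemma svt_uptoP m mu T :
  reflect [/\ forall b, (T b != set0) = (b.2 < mu b.1)%N,
      forall b a, a \in T b -> (0 < a <= m)%N,
      forall b b' a c, b.1 = b'.1 -> b'.2 = b.2.+1 :> nat ->
        a \in T b -> c \in T b' -> (a <= c)%N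
    & forall b b' a c, b'.1 = b.1.+1 :> nat -> b.2 = b'.2 ->
        a \in T b -> c \in T b' -> (a < c)%N]
  (svt_upto m mu T).
Proof.
apply: (iffP and4P) => -[h1 h2 h3 h4]; split.
- by move=> b; apply: eqP (forallP h1 b).
- by move=> b a; have /forallP/(_ a)/implyP := forallP h2 b.
- move=> b b' a c e1 e2 aT cT; have /implyP := forallP (forallP h3 b) b'.
  by rewrite e1 e2 !eqxx => /(_ isT)/forall_inP/(_ a aT)/forall_inP; apply.
- move=> b b' a c e1 e2 aT cT; have /implyP := forallP (forallP h4 b) b'.
  by rewrite e1 e2 !eqxx => /(_ isT)/forall_inP/(_ a aT)/forall_inP; apply.
- by apply/forallP => b; rewrite h1.
- by apply/forallP => b; apply/forall_inP => a; apply: h2.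
- apply/forallP => b; apply/forallP => b'; apply/implyP => /andP[/eqP e1 /eqP e2].
  by apply/forall_inP => a aT; apply/forall_inP => c cT; apply: h3 aT cT.
- apply/forallP => b; apply/forallP => b'; apply/implyP => /andP[/eqP e1 /eqP e2].
  by apply/forall_inP => a aT; apply/forall_inP => c cT; apply: h4 aT cT.
Qed.

Lemma eq_svt_upto m mu mu' T :
  (forall i, (i < n)%N -> mu i = mu' i) -> svt_upto m mu T = svt_upto m mu' T.
Proof.
by move=> e; congr andb; apply: eq_forallb => b; rewrite e.
Qed.

Lemma mem_set_neq0 (A : {set 'I_n.+1}) a : a \in A -> A != set0.
Proof. by move=> aA; apply/set0Pn; exists a. Qed.

(** Going up a column, boxes stay inside the shape and entries drop strictly while remaining
    positive. Consequently entries at most [m] occupy only the first [m] rows. *)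
Lemma svt_upto_row_lt m mu T b a : (forall i, (mu i.+1 <= mu i)%N) ->
  svt_upto m mu T -> a \in T b -> (b.1 < a)%N.
Proof.
move=> dec /svt_uptoP[ne bd _ col]; case: b => i j /=.
move: {2}(i : nat) (erefl (i : nat)) => k; elim: k i a => [|k IHk] i a ik aT.
  by rewrite ik; have /andP[] := bd _ _ aT.
have ltk : (k < n)%N by rewrite ltnW // -ik.
have: T (Ordinal ltk, j) != set0.
  by rewrite ne (leq_trans _ (dec k)) // -ik -(ne (i, j)); apply: mem_set_neq0 aT.
case/set0Pn => c cT; have := IHk (Ordinal ltk) c erefl cT.
by have := col (Ordinal ltk, j) (i, j) c a ik erefl cT aT; rewrite ik /=; lia.
Qed.

Definition row_len (P : pred cell) (i : nat) : nat :=
  #|[set b : cell | (b.1 == i :> nat) && P b]|.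

Lemma card_ord_lt k : (k <= M)%N -> #|[set j : 'I_M | (j < k)%N]| = k.
Proof.
by move=> le; rewrite -sum1_card (eq_bigl (fun j : 'I_M => (j < k)%N)) => [|j];
  rewrite ?inE // (big_ord_narrow le) sum1_card card_ord.
Qed.

(** A predicate closed under passing to the left neighbour cuts out an initial segment of each row,
    and this segment is determined by its cardinality. *)
Lemma row_lenP (P : pred cell) :
  (forall b b', b.1 = b'.1 -> b'.2 = b.2.+1 :> nat -> P b' -> P b) ->
  forall b, P b = (b.2 < row_len P b.1)%N.
Proof.
move=> down [i j] /=.
have -> : row_len P i = #|[set j | P (i, j)]|.
  have inj : injective (pair i : 'I_M -> cell) by move=> x y [].
  rewrite -(card_imset _ inj); apply: eq_card => -[i' j'].
  rewrite inE /= val_eqE; apply/andP/imsetP => [[/eqP -> Pij]|[x]].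
    by exists j'; rewrite ?inE.
  by rewrite inE => Px [-> ->].
have down' (k l : 'I_M) : (k <= l)%N -> P (i, l) -> P (i, k).
  move: {2}(l : nat) (erefl (l : nat)) => x; elim: x l => [|x IHx] l lx.
    by rewrite lx leqn0 => /eqP k0; rewrite (_ : l = k) //; apply/val_inj/(etrans lx).
  rewrite leq_eqVlt => /predU1P[/val_inj -> //|]; rewrite lx ltnS => kx Pl.
  have ltx : (x < M)%N by rewrite ltnW // -lx.
  by apply: (IHx (Ordinal ltx)) => //; apply: down Pl => //=.
apply/idP/idP => [Pj|].
  rewrite -(card_ord_lt j.+1) //; apply/subset_leq_card/subsetP => k.
  by rewrite !inE ltnS => /down'; apply.
apply: contraLR => nPj; rewrite -leqNgt -(card_ord_lt j); last exact/ltnW.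
apply/subset_leq_card/subsetP => k; rewrite !inE ltnNge.
by apply: contraL => /down' h; apply: contra nPj; apply: h.
Qed.

Lemma row_len_le P i : (row_len P i <= M)%N.
Proof.
rewrite -[X in (_ <= X)%N]card_ord /row_len.
set A := [set b | _]; have inj : {in A &, injective (@snd 'I_n 'I_M)}.
  move=> [i1 j1] [i2 j2]; rewrite !inE /= => /andP[/eqP e1 _] /andP[/eqP e2 _].
  by move=> ->; congr pair; exact/val_inj/(etrans e1 (esym e2)).
by rewrite -(card_in_imset inj) max_card.
Qed.

(** In row [i] the entry [e] occupies the columns from [nu i] up to the end of the row of [la]. *)
Definition add_entry (e : 'I_n.+1) la nu T : filling :=
  [ffun b : cell => if (nu b.1 <= b.2 < la b.1)%N then e |: T b else T b].

(** The first inequality keeps boxes of [la] from lying below a box with [e]; the last lets at most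
    one box per row hold [e] together with smaller entries. *)
Definition interlaced la nu mu :=
  forall i, [&& la i.+1 <= nu i, nu i <= mu i, mu i <= la i & mu i <= (nu i).+1]%N.

Lemma in_add_entry e la nu T b a : (a \in add_entry e la nu T b) =
  (a == e) && (nu b.1 <= b.2 < la b.1)%N || (a \in T b).
Proof. by rewrite ffunE; case: ifP; rewrite ?inE ?andbT ?andbF. Qed.

Lemma svt_add_entry m (e : 'I_n.+1) la nu mu T : e = m.+1 :> nat ->
  interlaced la nu mu -> svt_upto m mu T ->
  svt_upto m.+1 la (add_entry e la nu T).
Proof.
move=> em int /svt_uptoP[ne bd row col].
have inT b a : a \in T b -> (b.2 < mu b.1)%N by rewrite -ne; apply: mem_set_neq0.
apply/svt_uptoP; split.
- move=> b; have := int b.1; have := ne b; rewrite ffunE.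
  case: ifP => [h _ _|h -> ]; last by lia.
  by case/andP: h => _ ->; apply/mem_set_neq0/setU11.
- move=> b a; rewrite in_add_entry => /orP[/andP[/eqP -> _]|/bd]; lia.
- move=> b b' a c e1 e2; rewrite !in_add_entry.
  case/orP => [/andP[/eqP -> ha]|ha]; case/orP => [/andP[/eqP -> //  hc]|hc].
  + by have := inT _ _ hc; have := int b.1; rewrite -e1 e2; lia.
  + by have := bd _ _ ha; lia.
  + exact: row ha hc.
- move=> b b' a c e1 e2; rewrite !in_add_entry.
  case/orP => [/andP[/eqP -> ha]|ha]; case/orP => [/andP[/eqP -> //  hc]|hc].
  + by have := int b.1; rewrite -e1 -e2 in hc *; lia.
  + by have := inT _ _ hc; have := int b.1; have := int b'.1; rewrite -e1 -e2; lia.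
  + by have := bd _ _ ha; lia.
  + exact: col ha hc.
Qed.

Lemma add_entryK (e : 'I_n.+1) la nu mu m T : e = m.+1 :> nat ->
  svt_upto m mu T -> forall b, T b = add_entry e la nu T b :\ e.
Proof.
move=> em /svt_uptoP[_ bd _ _] b; apply/setP => a.
rewrite in_setD1 in_add_entry; case: eqP => [->|//] /=.
by apply/negP => /bd; rewrite em ltnn andbF.
Qed.

Lemma bounded_eq k l : (k <= M)%N -> (l <= M)%N ->
  (forall j : 'I_M, (j < k) = (j < l))%N -> k = l.
Proof.
move=> lek lel e; rewrite -(card_ord_lt k) // -(card_ord_lt l) //.
by apply: eq_card => j; rewrite !inE e.
Qed.

(** Erasing [e] recovers the filling, its nonempty boxes recover [mu], and the boxes holding [e]
    recover [nu]. *)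
Lemma add_entry_inj m (e : 'I_n.+1) la nu mu nu' mu' T T' : e = m.+1 :> nat ->
  (forall i, la i <= M)%N ->
  interlaced la nu mu -> interlaced la nu' mu' ->
  svt_upto m mu T -> svt_upto m mu' T' ->
  add_entry e la nu T = add_entry e la nu' T' ->
  T = T' /\ forall i, (i < n)%N -> mu i = mu' i /\ nu i = nu' i.
Proof.
move=> em laM int int' ST ST' eqT.
have TT' : T = T'.
  apply/ffunP => b; rewrite (add_entryK _ la nu _ _ _ em ST) eqT.
  by rewrite -(add_entryK _ la nu' _ _ _ em ST').
split=> // i ltin; rewrite -{}TT' in ST' eqT.
have [ne bd _ _] := svt_uptoP _ _ _ ST; have [ne' _ _ _] := svt_uptoP _ _ _ ST'.
have := int i; have := int' i; have := laM i => lai i1 i2.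
split; apply: bounded_eq; try lia; move=> j.
  by rewrite -[LHS](ne (Ordinal ltin, j)) ne'.
have: e \in add_entry e la nu T (Ordinal ltin, j) =
      (e \in add_entry e la nu' T (Ordinal ltin, j)) by rewrite eqT.
have /negPf eT : e \notin T (Ordinal ltin, j).
  by apply/negP => /bd; rewrite em ltnn andbF.
by rewrite !in_add_entry eT eqxx /= !orbF; lia.
Qed.

(** Surjectivity of [add_entry]: [mu] is the shape left after erasing [e], and [nu] counts the boxes
    of each row that avoid [e]. *)
Lemma svt_remove_entry m (e : 'I_n.+1) la T : e = m.+1 :> nat ->
  (forall i, la i.+1 <= la i)%N -> (forall i, la i <= M)%N ->
  (forall i, (m < i)%N -> la i = 0%N) ->
  svt_upto m.+1 la T ->
  exists nu mu T', [/\ interlaced la nu mu, (forall i, (m <= i)%N -> mu i = 0%N),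
    svt_upto m mu T' & T = add_entry e la nu T'].
Proof.
move=> em dec laM la0 ST; have [ne bd row col] := svt_uptoP _ _ _ ST.
have ltmn : (m < n)%N by rewrite -ltnS -em.
have entry_le b a : a \in T b -> (a <= e)%N by move=> /bd; rewrite em => /andP[].
have lt_e b a : a \in T b -> a != e -> (a < e)%N.
  by move=> /entry_le ale ne_ae; rewrite ltn_neqAle ne_ae.
have nonempty b : (b.2 < la b.1)%N -> exists a, a \in T b.
  by rewrite -ne => /set0Pn.
have inla b a : a \in T b -> (b.2 < la b.1)%N by rewrite -ne; apply: mem_set_neq0.
(* [P1] holds for the boxes that keep an entry after the erasure, [P2] for the nonempty boxes
   without [e]; their row lengths are the witnesses for [mu] and [nu]. *)
pose P1 b := T b :\ e != set0; pose P2 b := (T b != set0) && (e \notin T b).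
have P1P b : reflect (exists2 a, a \in T b & (a < e)%N) (P1 b).
  apply: (iffP (set0Pn _)) => [[a]|[a aT lta]].
    by rewrite !inE => /andP[nae aT]; exists a => //; apply: (lt_e b).
  by exists a; rewrite !inE aT andbT; apply: contraTneq lta => ->; rewrite ltnn.
have P2P b a : a \in T b -> (forall a, a \in T b -> (a < e)%N) -> P2 b.
  move=> aT lte; rewrite /P2 (mem_set_neq0 _ _ aT); apply/negP => /lte.
  by rewrite ltnn.
(* An entry below [e] bounds every entry of the left neighbour. Together with [P21] this makes both
   predicates closed to the left. *)
have step b b' : b.1 = b'.1 -> b'.2 = b.2.+1 :> nat -> P1 b' -> P2 b.
  move=> e1 e2 /P1P[c cT ltc].
  have [|a aT] := nonempty b; first by have := inla _ _ cT; rewrite e1 e2; lia.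
  apply: (P2P _ a) => // a' a'T; exact: leq_ltn_trans (row _ _ _ _ e1 e2 a'T cT) ltc.
have P21 b : P2 b -> P1 b.
  case/andP => /set0Pn[a aT] ne_e; apply/P1P; exists a => //.
  by apply: (lt_e b) => //; apply: contraNneq ne_e => <-.
have lenP1 := row_lenP P1 (fun b b' e1 e2 h => P21 _ (step b b' e1 e2 h)).
have lenP2 := row_lenP P2 (fun b b' e1 e2 h => step b b' e1 e2 (P21 _ h)).
have le_row (x y i : nat) : (x <= M)%N -> (i < n -> forall j : 'I_M, j < x -> j < y)%N ->
    (n <= i -> x = 0)%N -> (x <= y)%N.
  move=> xM h x0; case: (ltnP i n) => [/h {}h|/x0 -> //].
  rewrite leqNgt; apply/negP => ltyx.
  by have := h (Ordinal (leq_trans ltyx xM)) ltyx; rewrite ltnn.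
have row0 P i : (n <= i)%N -> row_len P i = 0%N.
  move=> leni; apply/eqP; rewrite cards_eq0; apply/eqP/setP => b.
  by rewrite !inE ltn_eqF // (leq_trans (ltn_ord _)).
exists (row_len P2), (row_len P1), [ffun b : cell => T b :\ e]; split.
- move=> i; apply/and4P; split.
  + apply: (le_row _ _ i) => // [ltin j ltj|leni]; last by apply: la0; lia.
    have lti1 : (i.+1 < n)%N.
      by rewrite ltnNge; apply/negP => leni; move: ltj; rewrite la0 //; lia.
    rewrite -(lenP2 (Ordinal ltin, j)).
    have [c cT] := nonempty (Ordinal lti1, j) ltj.
    have [|a aT] := nonempty (Ordinal ltin, j); first exact: leq_trans ltj (dec i).
    apply: (P2P _ a) => // a' a'T.
    have := col (Ordinal ltin, j) (Ordinal lti1, j) a' c erefl erefl a'T cT.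
    by move=> /leq_trans; apply; apply: entry_le cT.
  + apply: (le_row _ _ i) => [|ltin j|]; [exact: row_len_le| |exact: row0].
    by rewrite -(lenP2 (Ordinal ltin, j)) -(lenP1 (Ordinal ltin, j)); apply: P21.
  + apply: (le_row _ _ i) => [|ltin j|]; [exact: row_len_le| |exact: row0].
    by rewrite -(lenP1 (Ordinal ltin, j)) => /P1P[a /inla].
  (* Otherwise the box in column [row_len P2 i + 1] would satisfy [P1], and [step] would put [P2] on
     column [row_len P2 i], just past the end of its segment. *)
  + rewrite leqNgt; apply/negP => lt2.
    case: (ltnP i n) => [ltin|leni]; last by rewrite !row0 in lt2.
    have ltM := leq_trans lt2 (row_len_le _ _).
    pose b' : cell := (Ordinal ltin, Ordinal ltM).
    have P1b' : P1 b' by rewrite lenP1.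
    have := step (Ordinal ltin, Ordinal (ltnW ltM)) b' erefl erefl P1b'.
    by rewrite lenP2 /= ltnn.
- move=> i lemi; case: (ltnP i n) => [ltin|]; last exact: row0.
  apply/eqP; rewrite -leqn0.
  apply: (le_row _ _ i) => [|_ j|]; [exact: row_len_le| |exact: row0].
  rewrite -(lenP1 (Ordinal ltin, j)) => /P1P[a aT].
  by have := svt_upto_row_lt _ _ _ _ _ dec ST aT; rewrite em /=; lia.
- apply/svt_uptoP; split.
  + by move=> b; rewrite ffunE -lenP1.
  + move=> b a; rewrite ffunE !inE => /andP[ae aT].
    by have := lt_e _ _ aT ae; have := bd _ _ aT; lia.
  + move=> b b' a c e1 e2; rewrite !ffunE !inE => /andP[_ aT] /andP[_ cT].
    exact: row e1 e2 aT cT.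
  + move=> b b' a c e1 e2; rewrite !ffunE !inE => /andP[_ aT] /andP[_ cT].
    exact: col e1 e2 aT cT.
- apply/ffunP => b; apply/setP => a; rewrite in_add_entry ffunE !inE.
  have [->|_] := eqVneq; last by [].
  rewrite /= orbF leqNgt -lenP2 -ne /P2.
  by case: eqVneq => [->|_]; rewrite ?inE //= andbT negbK.
Qed.

Lemma sum_ord_lt k : (k <= M)%N -> (\sum_(j < M) (j < k) = k)%N.
Proof.
move=> lekM; rewrite -[RHS]card_ord_lt // -sum1_card [RHS]big_mkcond /=.
by apply: eq_bigr => j _; rewrite inE; case: (j < k)%N.
Qed.

(** * Weighted sums of fillings and their branching recursion *)

Section Weights.
Variables (R : comNzRingType) (beta : R).

(** Box by box, this is [beta] to the power of the size of [T] minus the size of its shape; the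
    predecessor of 0 being 0, empty boxes contribute 1. *)
Definition excess_weight T : R := \prod_b beta ^+ (#|T b|.-1).

(** A factor [beta] is gained exactly where [e] joins earlier entries, that is in columns from
    [nu i] to [mu i], the latter excluded. *)
Lemma excess_weight_add m (e : 'I_n.+1) la nu mu T : e = m.+1 :> nat ->
  (forall i, la i <= M)%N -> interlaced la nu mu -> svt_upto m mu T ->
  excess_weight (add_entry e la nu T)
  = (\prod_(i < n) beta ^+ (mu i - nu i)) * excess_weight T.
Proof.
move=> em laM int ST; have [ne bd _ _] := svt_uptoP _ _ _ ST.
have -> : \prod_(i < n) beta ^+ (mu i - nu i) =
          \prod_(b : cell) beta ^+ (nu b.1 <= b.2 < mu b.1)%N.
  rewrite -(pair_bigA _ (fun (i : 'I_n) (j : 'I_M) => beta ^+ (nu i <= j < mu i)%N)).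
  apply: eq_bigr => i _; rewrite prodrXr; congr (_ ^+ _) => /=.
  have := laM i; have /and4P[_ le1 le2 _] := int i => le3.
  (* Adding the columns before [nu i] completes the interval to an initial segment of length
     [mu i]. *)
  apply: (@addIn (\sum_(j < M) (j < nu i))%N); rewrite -big_split /=.
  rewrite sum_ord_lt ?subnK //; last by lia.
  rewrite -[LHS]sum_ord_lt; last by lia.
  by apply: eq_bigr => j _; case: (ltnP j (nu i)); case: (ltnP j (mu i)); lia.
rewrite -big_split; apply: eq_bigr => b _ /=; rewrite ffunE -exprD.
congr (_ ^+ _); have := int b.1; have := ne b; rewrite -card_gt0.
have /negPf eT : e \notin T b by apply/negP => /bd; rewrite em ltnn andbF.
case: ifP => h; rewrite ?cardsU1 ?eT /=; case: (#|T b|) => [|k] /=; lia.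
Qed.

(** [add_entry] is a bijection from pairs of an interlacing datum and a smaller filling. Since
    [mu i - nu i] is 0 or 1, a boolean records it in [p]. *)
Lemma sum_svt_rec m la : (m < n)%N ->
  (forall i, la i.+1 <= la i)%N -> (la 0 <= M)%N ->
  (forall i, (m < i)%N -> la i = 0%N) ->
  \sum_(T | svt_upto m.+1 la T) excess_weight T
  = \sum_(p : {ffun 'I_m -> 'I_M.+1 * bool} |
            [forall i : 'I_m, (la i.+1 + (p i).2 <= (p i).1 <= la i)%N])
      (\prod_i beta ^+ (p i).2) *
      \sum_(T | svt_upto m (pad m (fun i => (p i).1)) T) excess_weight T.
Proof.
move=> ltmn dec la0 la_m.
have laM i : (la i <= M)%N by elim: i => // i IHi; apply: leq_trans IHi.
pose e : 'I_n.+1 := Ordinal (ltmn : (m.+1 < n.+1)%N).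
pose mu (p : {ffun 'I_m -> 'I_M.+1 * bool}) := pad m (fun i => (p i).1).
pose nu (p : {ffun 'I_m -> 'I_M.+1 * bool}) := pad m (fun i => (p i).1 - (p i).2)%N.
pose ok (p : {ffun 'I_m -> 'I_M.+1 * bool}) :=
  [forall i : 'I_m, (la i.+1 + (p i).2 <= (p i).1 <= la i)%N].
have int p : ok p -> interlaced la (nu p) (mu p).
  move=> /forallP okp i; rewrite /mu /nu; case: (ltnP i m) => [ltim|leim].
    rewrite !(pad_ord _ _ (Ordinal ltim)); have := okp (Ordinal ltim) => /=.
    by case: (p _) => u [] /=; lia.
  by rewrite !pad_ge // la_m.
under [RHS]eq_bigr do rewrite mulr_sumr.
rewrite (pair_big_dep _ (fun p T => svt_upto m (mu p) T)
  (fun p T => (\prod_i beta ^+ (p i).2) * excess_weight T)) /=.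
pose A := [set x : {ffun 'I_m -> 'I_M.+1 * bool} * filling |
  ok x.1 && svt_upto m (mu x.1) x.2].
pose h (x : {ffun 'I_m -> 'I_M.+1 * bool} * filling) := add_entry e la (nu x.1) x.2.
have injh : {in A &, injective h}.
  move=> [p T] [q U]; rewrite !inE /= => /andP[okp ST] /andP[okq SU] eqh.
  have [-> eqi] := add_entry_inj _ _ _ _ _ _ _ _ _ (erefl : e = m.+1 :> nat)
    laM (int _ okp) (int _ okq) ST SU eqh.
  congr pair; apply/ffunP => i; have [] := eqi i.
    exact: leq_trans (ltn_ord i) (ltnW ltmn).
  rewrite /mu /nu !pad_ord; move/forallP/(_ i): okp; move/forallP/(_ i): okq.
  case: (p i) (q i) => [u x] [v y] /= h1 h2 h3 h4; congr pair; first exact: val_inj.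
  by case: x y h1 h2 h4 => [] [] //=; lia.
have imh T : (T \in h @: A) = svt_upto m.+1 la T.
  apply/imsetP/idP => [[[p U]]|ST].
    by rewrite inE /= => /andP[okp SU ->]; apply: svt_add_entry (int _ okp) SU.
  have [nuT [muT [U [intT mu0 SU eqT]]]] :=
    svt_remove_entry _ _ _ _ (erefl : e = m.+1 :> nat) dec laM la_m ST.
  (* The row lengths [muT i] are at most [M], so [inord] loses nothing. *)
  pose p : {ffun 'I_m -> 'I_M.+1 * bool} :=
    [ffun i : 'I_m => (inord (muT i), (nuT i < muT i)%N)].
  have muM i : (muT i < M.+1)%N by have := laM i; have := intT i; lia.
  have mup i : mu p i = muT i.
    rewrite /mu; case: (ltnP i m) => [lt|le]; last by rewrite pad_ge // mu0.
    by rewrite (pad_ord _ _ (Ordinal lt)) ffunE /= inordK.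
  have nup i : nu p i = nuT i.
    rewrite /nu; case: (ltnP i m) => [lt|le].
      by rewrite (pad_ord _ _ (Ordinal lt)) ffunE /= inordK //; have := intT i; lia.
    by rewrite pad_ge //; have := intT i; rewrite mu0 //; lia.
  exists (p, U); last first.
    by rewrite eqT; apply/ffunP => b; rewrite !ffunE /= nup.
  rewrite inE /= (eq_svt_upto _ _ _ _ (fun i _ => mup i)) SU andbT.
  by apply/forallP => i; rewrite ffunE /= inordK //; have := intT i; lia.
rewrite -(eq_bigl _ _ imh) big_imset //=; apply: eq_big => [x|[p U]]; rewrite inE //=.
move=> /andP[okp SU].
rewrite (excess_weight_add _ _ _ _ _ _ (erefl : e = m.+1 :> nat) laM (int _ okp) SU).
congr (_ * _).
have nu0 i : (m <= i)%N -> mu p i = 0%N by move=> lemi; rewrite /mu pad_ge.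
rewrite (bigID (fun i : 'I_n => (i < m)%N)) /= [X in _ * X]big1 ?mulr1 => [|i].
  rewrite (big_ord_narrow (ltnW ltmn)) /=; apply: eq_bigr => i _.
  rewrite /mu /nu !(pad_ord _ _ i); congr (_ ^+ _).
  by move/forallP/(_ i): okp; case: (p i) => u [] /=; lia.
by rewrite -leqNgt => /nu0 ->; rewrite expr0.
Qed.
End Weights.
End Fillings.

(** * Equality of the weighted sum with the shape determinant *)

Lemma sum_svt_shape_det_neqN1 (R : idomainType) (beta : R) n M m la :
  1 + beta != 0 -> (m <= n)%N ->
  (forall i, la i.+1 <= la i)%N -> (la 0 <= M)%N ->
  (forall i, (m <= i)%N -> la i = 0%N) ->
  \sum_(T | svt_upto n M m la T) excess_weight n M R beta T
  = shape_det R beta m la.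
Proof.
move=> beta_neq; elim: m la => [|m IHm] la lemn dec la0 la_m.
  (* With no rows the only filling is empty, of weight 1, and the determinant of size 0 is 1. *)
  rewrite (big_pred1 [ffun => set0]) => [|T]; last first.
    apply/idP/eqP => [/svt_uptoP[ne _ _ _]|->].
      by apply/ffunP => b; rewrite ffunE; apply/eqP/negbFE; rewrite ne la_m.
    by apply/svt_uptoP; split=> [b|b a|b b' a c _ _|b b' a c _ _];
      rewrite ffunE ?eqxx ?la_m ?inE.
  rewrite /shape_det det_mx00; apply: big1 => b _.
  by rewrite ffunE cards0 expr0.
(* Cancelling this factor in [shape_det_rec] gives the recursion of [sum_svt_rec]. *)
have /mulfI : (1 + beta) ^+ m != 0 by rewrite expf_neq0.
apply; rewrite (shape_det_rec _ _ _ M) // sum_svt_rec //; congr (_ * _).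
apply: eq_bigr => p /forallP okp; rewrite IHm // => [|i||i lemi]; first exact: ltnW.
- case: (ltnP i.+1 m) => [lt|le]; last by rewrite pad_ge.
  rewrite (pad_ord _ _ (Ordinal lt)) (pad_ord _ _ (Ordinal (ltnW lt))).
  by have := okp (Ordinal lt); have := okp (Ordinal (ltnW lt)) => /=; lia.
- case: (posnP m) => [m0|lt]; first by rewrite pad_ge // m0.
  by rewrite (pad_ord _ _ (Ordinal lt)) -ltnS.
- exact: pad_ge.
Qed.

(** * Compatibility of both sides with ring morphisms *)

Section Specialization.
Variables (R S : comNzRingType) (f : {rmorphism R -> S}) (beta : R).

Lemma rmorph_binshift r q h : f (binshift R beta r q h) = binshift S (f beta) r q h.
Proof.
by elim: r h => [|r IHr] h /=; rewrite ?rmorph_nat // rmorphD rmorphM /= !IHr.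
Qed.

Lemma rmorph_shape_det m la :
  f (shape_det R beta m la) = shape_det S (f beta) m la.
Proof.
rewrite -det_map_mx; congr (\det _); apply/matrixP => i j.
by rewrite !mxE rmorph_binshift.
Qed.

Lemma rmorph_excess_weight n M T :
  f (excess_weight n M R beta T) = excess_weight n M S (f beta) T.
Proof. by rewrite rmorph_prod; apply: eq_bigr => b _; rewrite rmorphXn. Qed.
End Specialization.

(* [1 + beta] may vanish, but [1 + 'X] does not: specialize the identity for
   ['X : {poly R}]. *)
Lemma sum_svt_shape_det (R : idomainType) (beta : R) n M m la : (m <= n)%N ->
  (forall i, la i.+1 <= la i)%N -> (la 0 <= M)%N ->
  (forall i, (m <= i)%N -> la i = 0%N) ->
  \sum_(T | svt_upto n M m la T) excess_weight n M R beta T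
  = shape_det R beta m la.
Proof.
move=> lemn dec la0 la_m.
have X1 : (1 + 'X : {poly R}) != 0.
  by rewrite addrC -[1]opprK -polyCN polyXsubC_eq0.
have := congr1 (horner_eval beta)
  (sum_svt_shape_det_neqN1 _ _ _ _ _ _ X1 lemn dec la0 la_m).
rewrite rmorph_sum rmorph_shape_det /= /horner_eval hornerX => <-.
apply: eq_bigr => T _.
have := rmorph_excess_weight _ _ (horner_eval beta) 'X n M T.
by rewrite /= /horner_eval hornerX.
Qed.

(** * Grothendieck polynomials and semistandard tableaux as determinants *)

Section Tableaux.
Variables (n : nat) (lam : 'I_n -> nat).
Local Notation inlam := (@inside n lam).
Hypothesis lam_dec : forall i j : 'I_n, (i <= j)%N -> (lam j <= lam i)%N.

Lemma pad_dec i : (pad n lam i.+1 <= pad n lam i)%N.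
Proof.
case: (ltnP i.+1 n) => [lt|le]; last by rewrite pad_ge.
rewrite (pad_ord _ _ (Ordinal lt)) (pad_ord _ _ (Ordinal (ltnW lt))).
exact: lam_dec.
Qed.

Lemma pad_le_max i : (pad n lam i <= lam_max lam)%N.
Proof.
case: (ltnP i n) => [lt|le]; last by rewrite pad_ge.
by rewrite (pad_ord _ _ (Ordinal lt)) (leq_bigmax (Ordinal lt)).
Qed.

Lemma mem_SVT T : (T \in SVT lam) = svt_upto n (lam_max lam) n (pad n lam) T.
Proof.
rewrite inE; apply/idP/svt_uptoP.
  case/andP => /andP[/forallP h1 /forallP h2] /forallP h3.
  have ne b : (T b != set0) = inlam b.
    by have := h1 b; case: ifP => [_ /andP[]|_ /eqP ->] //; rewrite eqxx.
  have ins b a : a \in T b -> inlam b by rewrite -ne; apply: mem_set_neq0.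
  split=> [b|b a aT|b b' a c e1 e2 aT cT|b b' a c e1 e2 aT cT].
  - by rewrite ne /inside pad_ord.
  - have := h1 b; rewrite (ins _ _ aT) => /andP[_ n0].
    apply/andP; split; last by rewrite -ltnS ltn_ord.
    rewrite lt0n; apply: contraNneq n0 => a0.
    by rewrite (_ : ord0 = a) //; apply: val_inj.
  - have /implyP := forallP (h2 b) b'; rewrite (ins _ _ aT) (ins _ _ cT).
    rewrite /right_of e1 e2 !eqxx => /(_ isT)/forall_inP/(_ a aT)/forall_inP.
    exact.
  - have /implyP := forallP (h3 b) b'; rewrite (ins _ _ aT) (ins _ _ cT).
    rewrite /below e1 e2 !eqxx => /(_ isT)/forall_inP/(_ a aT)/forall_inP.
    exact.
case=> ne bd row col; apply/andP; split; [apply/andP; split|].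
- apply/forallP => b; have := ne b; rewrite pad_ord /inside.
  case: ifP => _ neb; last by move/negbFE: neb.
  by rewrite neb /=; apply/negP => /bd.
- apply/forallP => b; apply/forallP => b'.
  apply/implyP => /andP[_ /andP[/eqP e1 /eqP e2]].
  by apply/forall_inP => a aT; apply/forall_inP => c cT; apply: row aT cT.
- apply/forallP => b; apply/forallP => b'.
  apply/implyP => /andP[_ /andP[/eqP e1 /eqP e2]].
  apply/forall_inP => a aT; apply/forall_inP => c cT; apply: col aT cT => //.
  exact: val_inj.
Qed.

Lemma inside_size : (\sum_(b : box lam) inlam b = lam_size lam)%N.
Proof.
rewrite -(pair_bigA _ (fun (i : 'I_n) (j : 'I_(lam_max lam)) =>
  nat_of_bool (j < lam i)%N)) /=.
by apply: eq_bigr => i _; rewrite sum_ord_lt // -(pad_ord _ lam) pad_le_max.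
Qed.

(** At [x = 1] only the power of [beta] remains, and its exponent is the sum over the boxes of the
    number of entries beyond the first. *)
Lemma grothendieck1 (C : comNzRingType) (beta : C) :
  grothendieck lam (fun _ => 1) beta
  = \sum_(T | svt_upto n (lam_max lam) n (pad n lam) T)
      excess_weight n (lam_max lam) C beta T.
Proof.
apply: eq_big => [T|T]; rewrite mem_SVT // => /svt_uptoP[ne _ _ _].
rewrite /svt_weight big1 => [|m _]; last exact: expr1n.
rewrite mulr1 /excess_weight prodrXr; congr (_ ^+ _).
rewrite -inside_size /svt_size; apply/eqP; rewrite -(eqn_add2r (\sum_b inlam b)%N).
have e : (\sum_(b : box lam) #|T b| = \sum_(b : box lam) (#|T b|.-1 + inlam b))%N.
  apply: eq_bigr => b _; have := ne b; rewrite pad_ord /inside -card_gt0.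
  by move=> <-; case: #|_| => //= k; rewrite addn1.
by rewrite e big_split /= addnK.
Qed.

Lemma grothendieck_shape_det (C : idomainType) (beta : C) :
  grothendieck lam (fun _ => 1) beta = shape_det C beta n (pad n lam).
Proof.
rewrite grothendieck1 sum_svt_shape_det //; first exact: pad_dec.
  exact: pad_le_max.
by move=> i; apply: pad_ge.
Qed.

(** At [beta = 0] only fillings with at most one entry per box keep a nonzero weight, namely 1;
    these are the semistandard tableaux with entries replaced by singletons. *)
Lemma card_SST (C : idomainType) : (#|SST lam|)%:R = shape_det C 0 n (pad n lam).
Proof.
rewrite -grothendieck_shape_det grothendieck1.
pose s (T : {ffun box lam -> 'I_n.+1}) : {ffun box lam -> {set 'I_n.+1}} :=
  [ffun b => if inlam b then [set T b] else set0].
have injs : {in SST lam &, injective s}.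
  move=> T U; rewrite !inE => /andP[/andP[/forallP hT _] _] /andP[/andP[/forallP hU _] _].
  move=> /ffunP eqs; apply/ffunP => b; have := eqs b; have := hT b; have := hU b.
  by rewrite !ffunE; case: ifP => [_ _ _ /set1_inj|_ /eqP -> /eqP ->].
rewrite -(card_in_imset injs).
have sP U : (U \in s @: SST lam) =
    (U \in SVT lam) && [forall b, (#|U b| <= 1)%N].
  apply/imsetP/idP.
    case=> T; rewrite inE => /andP[/andP[/forallP h1 /forallP h2] /forallP h3] ->.
    rewrite inE; apply/andP; split; last first.
      by apply/forallP => b; rewrite ffunE; case: ifP; rewrite ?cards1 ?cards0.
    apply/andP; split; [apply/andP; split|].
    - apply/forallP => b; rewrite ffunE; have := h1 b; case: ifP => // _ T0.
      by rewrite inE [ord0 == _]eq_sym T0 andbT; apply/set0Pn; exists (T b); rewrite inE.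
    - apply/forallP => b; apply/forallP => b'; apply/implyP => h.
      have := implyP (forallP (h2 b) b') h; case/andP: h => /andP[ib ib'] _.
      rewrite !ffunE ib ib' => le.
      by apply/forall_inP => a /set1P ->; apply/forall_inP => c /set1P ->.
    - apply/forallP => b; apply/forallP => b'; apply/implyP => h.
      have := implyP (forallP (h3 b) b') h; case/andP: h => /andP[ib ib'] _.
      rewrite !ffunE ib ib' => le.
      by apply/forall_inP => a /set1P ->; apply/forall_inP => c /set1P ->.
  case/andP; rewrite inE => /andP[/andP[/forallP h1 /forallP h2] /forallP h3] /forallP le1.
  (* The default [ord0] agrees with the dummy value of [is_sst] outside the diagram. *)
  pose t b := odflt ord0 [pick a in U b].
  have tP b : inlam b -> U b = [set t b].
    have := h1 b; case: ifP => // _ /andP[/set0Pn[x xU] _] _.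
    have /eqP/cards1P[a ea] : #|U b| = 1%N.
      by apply/eqP; rewrite eqn_leq le1; apply/card_gt0P; exists x.
    rewrite ea /t ea; case: pickP => [y /set1P -> //|/(_ a)]; by rewrite inE eqxx.
  have t0 b : ~~ inlam b -> t b = ord0.
    have := h1 b; case: ifP => // _ /eqP e _; rewrite /t e.
    by case: pickP => // a; rewrite inE.
  exists [ffun b => t b]; last first.
    apply/ffunP => b; rewrite !ffunE; case: ifP => [/tP //|ib].
    by have := h1 b; rewrite ib => /eqP.
  rewrite inE; apply/andP; split; [apply/andP; split|].
  - apply/forallP => b; rewrite ffunE; case: ifP => [ib|/negbT/t0 -> //].
    by have := h1 b; rewrite ib tP // inE [ord0 == _]eq_sym => /andP[].
  - apply/forallP => b; apply/forallP => b'; apply/implyP => h; rewrite !ffunE.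
    have := implyP (forallP (h2 b) b') h; case/andP: h => /andP[ib ib'] _.
    rewrite (tP _ ib) (tP _ ib') => /forall_inP/(_ _ (set11 _))/forall_inP.
    by apply; rewrite set11.
  - apply/forallP => b; apply/forallP => b'; apply/implyP => h; rewrite !ffunE.
    have := implyP (forallP (h3 b) b') h; case/andP: h => /andP[ib ib'] _.
    rewrite (tP _ ib) (tP _ ib') => /forall_inP/(_ _ (set11 _))/forall_inP.
    by apply; rewrite set11.
rewrite -sum1_card natr_sum (eq_bigl _ _ sP) -(eq_bigl _ _ mem_SVT).
rewrite [LHS]big_mkcondr; apply: eq_bigr => T _; rewrite /excess_weight prodrXr.
rewrite expr0n sum_nat_eq0.
have -> : [forall (b | true), #|T b|.-1 == 0]%N = [forall b, #|T b| <= 1]%N.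
  by apply: eq_forallb => b; case: #|_| => [|[]].
by case: ifP.
Qed.
End Tableaux.

(** * Vandermonde evaluation of binomial determinants, and Pochhammer symbols *)

Section BinomialIdentities.
Variables (C : numClosedFieldType) (n : nat).

(** ['C(y, q)] is a polynomial in [y] of degree [q], so the matrix is a Vandermonde matrix times the
    coefficient matrix [W]. The constant [K] is independent of [y], hence shared by all terms of the
    expansion. *)
Lemma bin_det_Vandermonde : exists K : C, forall y : 'I_n -> nat,
  \det (\matrix_(i, j) ('C(y i, rev_ord j))%:R)
  = K * \prod_(i < n) \prod_(j < n | (i < j)%N) ((y j)%:R - (y i)%:R).
Proof.
pose fallp q : {poly C} := \prod_(t < q) ('X - (t : nat)%:R%:P).
have size_fallp q : size (fallp q) = q.+1.
  by rewrite size_prod_XsubC -[index_enum _]enumT size_enum_ord.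
have fallpE q x : (fallp q).[x%:R] = (x ^_ q)%:R.
  rewrite horner_prod; elim: q => [|q IHq]; first by rewrite big_ord0 ffactn0.
  rewrite big_ord_recr /= IHq ffactnSr natrM hornerXsubC.
  (* For [q > x] the natural subtraction [x - q] truncates, but the falling factorial in front of it
     is already 0. *)
  case: (leqP q x) => [le|lt]; first by rewrite natrB.
  by rewrite ffact_small ?mul0r.
pose W : 'M[C]_n := \matrix_(l, j) ((fallp (rev_ord j))`_l / (rev_ord j)`!%:R).
have key (y : 'I_n -> nat) : \det (\matrix_(i, j) ('C(y i, rev_ord j))%:R)
  = \det W * \prod_(i < n) \prod_(j < n | (i < j)%N) ((y j)%:R - (y i)%:R) :> C.
  have -> : \prod_(i < n) \prod_(j < n | (i < j)%N) ((y j)%:R - (y i)%:R) =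
     \det (Vandermonde n (\row_i (y i)%:R : 'rV[C]_n)).
    rewrite det_Vandermonde; apply: eq_bigr => i _; apply: eq_bigr => j _.
    by rewrite !mxE.
  rewrite mulrC -[\det (Vandermonde _ _)]det_tr -det_mulmx; congr (\det _).
  apply/matrixP => i j; rewrite !mxE.
  have fact_neq0 : (rev_ord j)`!%:R != 0 :> C by rewrite pnatr_eq0 -lt0n fact_gt0.
  apply: (mulIf fact_neq0); rewrite -natrM bin_ffact -fallpE.
  rewrite (@horner_coef_wide _ n) ?size_fallp ?ltn_ord // mulr_suml.
  by apply: eq_bigr => l _; rewrite !mxE mulrCA -mulrA divfK // mulrC.
by exists (\det W).
Qed.

(** [(-i)_k] is a falling factorial up to the sign [(-1)^k], which cancels that of [(- beta) ^+ k],
    and [(1)_k] is the factorial. *)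
Lemma poch_bin (i k : nat) (beta : C) :
  poch (- i%:R : C) k * (poch (1 : C) k)^-1 * (- beta) ^+ k = 'C(i, k)%:R * beta ^+ k.
Proof.
have poch1 : poch (1 : C) k = k`!%:R.
  rewrite /poch; elim: k => [|k IHk]; first by rewrite big_ord0.
  by rewrite big_ord_recr /= IHk factS mulnC natrM -natr1 addrC.
have pochN : poch (- i%:R : C) k = (-1) ^+ k * (i ^_ k)%:R.
  rewrite /poch; elim: k {poch1} => [|k IHk].
    by rewrite big_ord0 ffactn0 expr0 mul1r.
  rewrite big_ord_recr /= IHk exprS ffactnSr natrM.
  case: (leqP k i) => [le|lt]; first by rewrite natrB //; ring.
  by rewrite ffact_small // !(mulr0, mul0r).
rewrite poch1 pochN -bin_ffact natrM [(- beta) ^+ k]exprNn.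
have fact_neq0 : k`!%:R != 0 :> C by rewrite pnatr_eq0 -lt0n fact_gt0.
have sign2 : (-1) ^+ k * (-1) ^+ k = 1 :> C by rewrite -expr2 sqrr_sign.
by rewrite mulrA mulfK // mulrACA sign2 mul1r.
Qed.
End BinomialIdentities.

Theorem theorem3p7 (C : numClosedFieldType) (n : nat) (lam : 'I_n -> nat) :
  (0 < n)%N ->
  (forall i j : 'I_n, (i <= j)%N -> (lam j <= lam i)%N) ->
  forall (beta : C) (N : nat), (n <= N)%N ->
    grothendieck lam (fun _ => 1) beta
    = (#|SST lam|)%:R *
      holmanF_trunc N (holA C lam) (holA_col C n) (const_mx 1 : 'M[C]_(n, 1))
        (fun _ => - beta).
Proof.
move=> _ lam_dec beta N leN.
rewrite grothendieck_shape_det // card_SST // /holmanF_trunc mulr_sumr.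
have [K vdm] := bin_det_Vandermonde C n.
(* These are the Vandermonde nodes: at [k = 0] their differences are the [A_ij], and [k] shifts them
   to [A_ij + k_i - k_j]. *)
pose h (k : 'I_n -> nat) (i : 'I_n) := (lam i + rev_ord i + k i)%N.
have hA i j : holA C lam i j = (h (fun _ => 0%N) i)%:R - (h (fun _ => 0%N) j)%:R.
  rewrite /h /holA !addn0 !natrD /= !natrB //.
  by rewrite -!natr1; ring.
have -> : shape_det C 0 n (pad n lam) =
    \det (\matrix_(i, j) ('C(h (fun _ => 0%N) i, rev_ord j))%:R).
  congr (\det _); apply/matrixP => i j; rewrite !mxE pad_ord /h addn0.
  move: (i : nat) (_ + _)%N => r x; elim: r x => //= r IHr x.
  by rewrite IHr mul0r addr0.
(* Row [i] carries the power [i < n <= N], so the expansion up to [N] is complete. *)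
have -> : shape_det C beta n (pad n lam) =
  \det (\matrix_(i, j) \sum_(k < N)
     ('C(i, k)%:R * beta ^+ k) * ('C(lam i + rev_ord i + k, rev_ord j))%:R).
  congr (\det _); apply/matrixP => i j; rewrite !mxE pad_ord.
  by rewrite (binshift_sum _ _ _ _ _ N) // (leq_trans (ltn_ord i)).
rewrite (det_rows_sum _ _ _ (fun _ => predT) (fun i (k : 'I_N) => 'C(i, k)%:R * beta ^+ k)
  (fun i k j => ('C(lam i + rev_ord i + k, rev_ord j))%:R)).
apply: eq_big => [k|k _]; first exact/forallP.
rewrite !big_ord1 -!mulrA.
set coefs := \prod_i ('C(_, _)%:R * _).
rewrite [X in _ = _ * (_ * X)](_ : _ = coefs); last first.
  by rewrite -!big_split; apply: eq_bigr => i _ /=; rewrite !mxE mulrA poch_bin.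
rewrite (vdm (h (fun i => k i))) vdm.
(* The quotient of the two Vandermonde products is Holman's product; the nodes at [k = 0] strictly
   decrease, so no denominator vanishes, and the reversed order of differences changes both products
   by the same sign. *)
have -> : \prod_(i < n) \prod_(j < n | (i < j)%N)
       ((h (fun i => k i) j)%:R - (h (fun i => k i) i)%:R) =
    \prod_(i < n) \prod_(j < n | (i < j)%N)
       ((h (fun _ => 0%N) j)%:R - (h (fun _ => 0%N) i)%:R) *
    \prod_(i < n) \prod_(j < n | (i < j)%N)
       ((holA C lam i j + (k i)%:R - (k j)%:R) / holA C lam i j) :> C.
  rewrite -big_split; apply: eq_bigr => i _; rewrite -big_split.
  apply: eq_bigr => j ltij /=; rewrite hA.
  have lth : (h (fun _ => 0%N) j < h (fun _ => 0%N) i)%N.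
    rewrite /h !addn0 -addnS leq_add ?lam_dec ?(ltnW ltij) //=.
    by have := ltn_ord j; lia.
  have : (h (fun _ => 0%N) i)%:R - (h (fun _ => 0%N) j)%:R != 0 :> C.
    by rewrite subr_eq0 eqr_nat gtn_eqF.
  by rewrite /h !addn0 !natrD => ?; field.
by ring.
Qed.
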